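(* Let $\Lambda_3$ be the largest constant such that $$\int_{S^{2}} f\,\Gamma_2(\log f,\log f)\, d\sigma \;\ge\; \Lambda_3 \int_{S^{2}} f\,|\nabla_\sigma \log f|^2\, d\sigma$$ holds for every positive symmetric (smooth) function $f$ on $S^2$. Then $$\Lambda_3\;\le\;\min_{t>0}\left[5(3t+1)(3t+2)-15(t+1)(3t+1)\sqrt{t}\,\arctan\left(\frac{1}{\sqrt{t}}\right)\right]\approx 5.73892.$$
   Context: $S^2\subset\mathbb{R}^3$ is the unit sphere with its round metric; $d\sigma$ is the surface measure normalized so that $\int_{S^2}d\sigma=1$; $\nabla_\sigma$ is the spherical (Riemannian) gradient and $\nabla_\sigma^2$ the Riemannian Hessian on $S^2$, with $\|\cdot\|$ the Hilbert–Schmidt norm. For a function $g$ on $S^2$, $\Gamma_2(g,g)=\|\nabla_\sigma^2 g\|^2+|\nabla_\sigma g|^2$. A function $f$ on $S^2$ is symmetric if $f(\sigma)=f(-\sigma)$ for every $\sigma\in S^2$. *)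

(* Defs.v *)
From Stdlib Require Import Reals.
From Coquelicot Require Import Coquelicot.
Open Scope R_scope.

(** Points of R^3 are triples, with Coquelicot's product structures. A function
    on the unit sphere is represented by a function on R^3, and every notion
    below that is about the sphere depends only on its values on [S2]. *)
Notation R3 := (R * R * R)%type.

Inductive axis : Set := ax1 | ax2 | ax3.

Definition coord (i : axis) (p : R3) : R :=
  match i with
  | ax1 => fst (fst p)
  | ax2 => snd (fst p)
  | ax3 => snd p
  end.

Definition basis (i : axis) : R3 :=
  match i with
  | ax1 => (1, 0, 0)
  | ax2 => (0, 1, 0)
  | ax3 => (0, 0, 1)
  end.

Definition sum3 (a : axis -> R) : R := a ax1 + a ax2 + a ax3.

Definition dot (p q : R3) : R := sum3 (fun i => coord i p * coord i q).

Definition S2 (p : R3) : Prop := dot p p = 1.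

Definition along (i : axis) (F : R3 -> R) (p : R3) (h : R) : R :=
  F (plus p (scal h (basis i))).

Definition partial (i : axis) (F : R3 -> R) (p : R3) : R :=
  Derive (along i F p) 0.

Fixpoint Ck_on (k : nat) (U : R3 -> Prop) (F : R3 -> R) : Prop :=
  (forall p, U p -> continuous F p) /\
  match k with
  | O => True
  | S k' =>
      forall i, (forall p, U p -> ex_derive (along i F p) 0) /\
                Ck_on k' U (partial i F)
  end.

(** Smoothness on an embedded submanifold: [f] is the restriction of a C^oo
    function defined on an open neighbourhood of the sphere. *)
Definition smooth_on_S2 (f : R3 -> R) : Prop :=
  exists (U : R3 -> Prop) (F : R3 -> R),
    open U /\ (forall p, S2 p -> U p) /\
    (forall k, Ck_on k U F) /\
    (forall p, S2 p -> F p = f p).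

Definition positive_on_S2 (f : R3 -> R) : Prop := forall p, S2 p -> 0 < f p.

Definition symmetric_on_S2 (f : R3 -> R) : Prop :=
  forall p, S2 p -> f p = f (opp p).

(** The extension of [g] that is constant along rays, [x |-> g (x / |x|)]. *)
Definition radial_ext (g : R3 -> R) (x : R3) : R :=
  g (scal (/ sqrt (dot x x)) x).

(** [sgrad g p i] is the [i]-th coordinate in R^3 of the Riemannian gradient of
    [g] at [p] on the sphere: the radial extension has zero normal derivative,
    so its Euclidean gradient at [p] is the tangent vector representing [dg]. *)
Definition sgrad (g : R3 -> R) (p : R3) (i : axis) : R :=
  partial i (radial_ext g) p.

Definition sgrad_norm2 (g : R3 -> R) (p : R3) : R :=
  sum3 (fun i => sgrad g p i ^ 2).

(** Orthogonal projection of R^3 onto the tangent plane at [p]. *)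
Definition tproj (p : R3) (i j : axis) : R :=
  coord i (basis j) - coord i p * coord j p.

(** The Riemannian Hessian at [p] is the endomorphism [v |-> D_v (grad g)] of
    the tangent plane, where the Levi-Civita derivative [D] of a tangent field
    is the tangential part of its componentwise derivative in R^3. [shess g p]
    is its matrix in the standard basis of R^3, extended by 0 in the normal
    direction: differentiating radial extensions already gives 0 there. *)
Definition shess (g : R3 -> R) (p : R3) (i j : axis) : R :=
  sum3 (fun k => tproj p i k * sgrad (fun q => sgrad g q k) p j).

Definition shess_norm2 (g : R3 -> R) (p : R3) : R :=
  sum3 (fun i => sum3 (fun j => shess g p i j ^ 2)).

(** [Gamma2 g] is Gamma_2(g, g). *)
Definition Gamma2 (g : R3 -> R) (p : R3) : R :=
  shess_norm2 g p + sgrad_norm2 g p.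

Definition sph (theta phi : R) : R3 :=
  (sin theta * cos phi, sin theta * sin phi, cos theta).

(** Surface integral in spherical coordinates, with area element
    [sin theta dtheta dphi], divided by the area [4 PI]. *)
Definition S2_int (F : R3 -> R) : R :=
  / (4 * PI) *
  RInt (fun phi => RInt (fun theta => F (sph theta phi) * sin theta) 0 PI)
       0 (2 * PI).

Definition log_of (f : R3 -> R) (p : R3) : R := ln (f p).

Definition Gamma2_ineq (Lambda : R) : Prop :=
  forall f : R3 -> R,
    smooth_on_S2 f -> positive_on_S2 f -> symmetric_on_S2 f ->
    S2_int (fun p => f p * Gamma2 (log_of f) p) >=
    Lambda * S2_int (fun p => f p * sgrad_norm2 (log_of f) p).

Definition is_largest (E : R -> Prop) (x : R) : Prop :=
  E x /\ forall y, E y -> y <= x.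

Definition is_min_pos (Phi : R -> R) (m : R) : Prop :=
  (exists t, 0 < t /\ Phi t = m) /\ (forall t, 0 < t -> m <= Phi t).

(* Main.v *)
(** The test functions [f(p) = (z ^ 2 + t) ^ 2], with [z] the third coordinate of
    [p], give the bound: on the sphere, the integrals for [f] reduce to integrals
    of rational functions of [z] over [[-1, 1]], and their quotient is exactly the
    function of [t] being minimized. For the numerical value, the inequality
    [Phi t >= c] is equivalent to [atan (1 / s) <= r_c (s)] with [s = sqrt t] and
    [r_c] rational; the derivative of the difference is rational, its numerator
    being a quadratic in [t], so its sign is explicit. *)
Require Import Defs.
From Stdlib Require Import Reals Machin Lra Lia FunctionalExtensionality.
From Coquelicot Require Import Coquelicot.
Open Scope R_scope.

(** * Zonal functions on the sphere *)

Lemma coord_plus i p q : coord i (plus p q) = coord i p + coord i q.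
Proof. destruct i; reflexivity. Qed.

Lemma coord_scal i a p : coord i (scal a p) = a * coord i p.
Proof. destruct i; reflexivity. Qed.

Lemma dot_scal a p : dot (scal a p) (scal a p) = a * a * dot p p.
Proof. unfold dot, sum3; rewrite !coord_scal; ring. Qed.

Lemma S2_coord_sum p :
  S2 p -> coord ax1 p ^ 2 + coord ax2 p ^ 2 + coord ax3 p ^ 2 = 1.
Proof. intros Hp; rewrite <- Hp; unfold dot, sum3; ring. Qed.

Lemma dot_along i p h :
  dot (plus p (scal h (basis i))) (plus p (scal h (basis i))) =
  dot p p + 2 * h * coord i p + h ^ 2.
Proof.
unfold dot, sum3; rewrite !coord_plus, !coord_scal.
destruct i; simpl; ring.
Qed.

(** [radial_ext g] is convertible to [g] composed with this map, so spherical gradients are computed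
    by the chain rule through it. *)
Definition to_sphere (p : R3) : R3 := scal (/ sqrt (dot p p)) p.

Lemma to_sphere_S2 p : 0 < dot p p -> S2 (to_sphere p).
Proof.
intros Hp; unfold S2, to_sphere.
pose proof (sqrt_lt_R0 _ Hp) as Hs.
rewrite dot_scal.
rewrite <- (sqrt_sqrt (dot p p)) at 3 by lra.
field; lra.
Qed.

Lemma to_sphere_id p : S2 p -> to_sphere p = p.
Proof.
unfold S2, to_sphere; intros ->; rewrite sqrt_1, Rinv_1.
exact (scal_one p).
Qed.

Lemma to_sphere_along_0 i p :
  S2 p -> to_sphere (plus p (scal 0 (basis i))) = p.
Proof.
intros Hp; replace (plus p (scal 0 (basis i))) with p.
  now apply to_sphere_id.
transitivity (plus p zero); [now rewrite plus_zero_r|].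
f_equal; symmetry; exact (scal_zero_l (basis i)).
Qed.

Lemma is_derive_to_sphere i k p :
  S2 p ->
  is_derive (fun h => coord k (to_sphere (plus p (scal h (basis i))))) 0
    (tproj p k i).
Proof.
intros Hp.
apply (is_derive_ext (fun h =>
  (coord k p + h * coord k (basis i)) / sqrt (1 + 2 * h * coord i p + h ^ 2))).
  intros h; unfold to_sphere.
  rewrite coord_scal, dot_along, coord_plus, coord_scal, Hp.
  apply Rmult_comm.
auto_derive; replace (1 + _ + _) with 1 by ring; rewrite ?sqrt_1.
  repeat split; lra.
unfold tproj.
replace (coord k (basis i)) with (coord i (basis k)) by now destruct i, k.
field.
Qed.

(** The closed form of the first gradient holds only on the sphere, so differentiating it again
    requires the normalized points to lie there for all small [h]. The squared norm before
    normalization is positive because |h| < 1 and |p_i| <= 1. *)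
Lemma locally_to_sphere_S2 i p :
  S2 p -> locally 0 (fun h => S2 (to_sphere (plus p (scal h (basis i))))).
Proof.
intros Hp; exists (mkposreal 1 Rlt_0_1); intros h Hh.
apply to_sphere_S2; rewrite dot_along, Hp.
assert (Hh' : -1 < h < 1).
  apply Rabs_def2 in Hh; unfold minus, plus, opp in Hh; simpl in Hh; lra.
pose proof (S2_coord_sum _ Hp).
assert (coord i p ^ 2 <= 1) by (destruct i; nra).
assert (-1 <= coord i p <= 1) by nra.
assert (0 < 1 + h * coord i p) by nra.
nra.
Qed.

Lemma sgrad_eq g p i l :
  is_derive (fun h => g (to_sphere (plus p (scal h (basis i))))) 0 l ->
  sgrad g p i = l.
Proof. exact (@is_derive_unique _ _ _). Qed.

Section Zonal.

Variables G G1 G2 : R -> R.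
Hypothesis HG : forall z, is_derive G z (G1 z).
Hypothesis HG1 : forall z, is_derive G1 z (G2 z).

Let g p := G (coord ax3 p).

Lemma sgrad_zonal p i : S2 p -> sgrad g p i = G1 (coord ax3 p) * tproj p ax3 i.
Proof.
intros Hp; apply sgrad_eq; unfold g.
replace (G1 _ * _)
  with (scal (tproj p ax3 i) (G1 (coord ax3 p))) by apply Rmult_comm.
apply (is_derive_comp G); [| now apply is_derive_to_sphere].
rewrite to_sphere_along_0 by easy; apply HG.
Qed.

Lemma sgrad_norm2_zonal p :
  S2 p ->
  sgrad_norm2 g p = G1 (coord ax3 p) ^ 2 * (1 - coord ax3 p ^ 2).
Proof.
intros Hp; pose proof (S2_coord_sum _ Hp) as H.
unfold sgrad_norm2, sum3; rewrite !sgrad_zonal by easy; unfold tproj; simpl coord in *.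
destruct p as [[x y] z]; simpl in *.
assert (Hx : x ^ 2 = 1 - y ^ 2 - z ^ 2) by (simpl; lra).
ring [Hx].
Qed.

Lemma sgrad_sgrad_zonal p k j :
  S2 p ->
  sgrad (fun q => sgrad g q k) p j =
  G2 (coord ax3 p) * tproj p ax3 j * tproj p ax3 k -
  G1 (coord ax3 p) *
  (tproj p ax3 j * coord k p + coord ax3 p * tproj p k j).
Proof.
intros Hp; apply sgrad_eq.
apply (is_derive_ext_loc (fun h =>
  let q := to_sphere (plus p (scal h (basis j))) in
  G1 (coord ax3 q) * (coord ax3 (basis k) - coord ax3 q * coord k q))).
  apply filter_imp with (2 := locally_to_sphere_S2 j p Hp); intros h Hh.
  now rewrite sgrad_zonal.
pose proof (is_derive_to_sphere j ax3 p Hp) as D3.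
pose proof (is_derive_to_sphere j k p Hp) as Dk.
set (a := fun h => coord ax3 _) in D3; set (b := fun h => coord k _) in Dk.
assert (H0 : to_sphere (plus p (scal 0 (basis j))) = p)
  by now apply to_sphere_along_0.
assert (Ha : a 0 = coord ax3 p) by exact (f_equal (coord ax3) H0).
assert (Hb : b 0 = coord k p) by exact (f_equal (coord k) H0).
change (is_derive (fun h => G1 (a h) * (coord ax3 (basis k) - a h * b h)) 0
  (G2 (coord ax3 p) * tproj p ax3 j * tproj p ax3 k -
  G1 (coord ax3 p) *
  (tproj p ax3 j * coord k p + coord ax3 p * tproj p k j))).
assert (DG : is_derive G1 (a 0) (G2 (a 0))) by apply HG1.
auto_derive.
  repeat split; eexists; eassumption.
rewrite (is_derive_unique (fun h : R => a h) _ _ D3).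
rewrite (is_derive_unique (fun h : R => b h) _ _ Dk).
rewrite (is_derive_unique (fun h : R => G1 h) _ _ DG), Ha, Hb.
unfold tproj; replace (coord k (basis ax3)) with (coord ax3 (basis k)) by now destruct k.
simpl; ring.
Qed.

(** Chain rule: G'' times the tensor square of grad z, plus G' times Hess z, which is -z times the
    tangent metric. The projection in [shess] removes the component along [p]. *)
Lemma shess_zonal p i j :
  S2 p ->
  shess g p i j =
  G2 (coord ax3 p) * tproj p ax3 i * tproj p ax3 j -
  coord ax3 p * G1 (coord ax3 p) * tproj p i j.
Proof.
intros Hp; pose proof (S2_coord_sum _ Hp) as H.
unfold shess, sum3; rewrite !sgrad_sgrad_zonal by easy; unfold tproj.
destruct p as [[x y] z]; simpl in *.
assert (Hx : x ^ 2 = 1 - y ^ 2 - z ^ 2) by (simpl; lra).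
destruct i, j; simpl; ring [Hx].
Qed.

(** In the meridian and parallel directions the Hessian has eigenvalues (1 - z^2) G'' - z G' and -z
    G'. The square of the latter and |grad g|^2 = (1 - z^2) G'^2 add up to G'^2. *)
Lemma Gamma2_zonal p :
  S2 p ->
  Gamma2 g p =
  (G2 (coord ax3 p) * (1 - coord ax3 p ^ 2) - coord ax3 p * G1 (coord ax3 p)) ^ 2
  + G1 (coord ax3 p) ^ 2.
Proof.
intros Hp; pose proof (S2_coord_sum _ Hp) as H.
unfold Gamma2; rewrite sgrad_norm2_zonal by easy.
unfold shess_norm2, sum3; rewrite !shess_zonal by easy; unfold tproj.
destruct p as [[x y] z]; simpl in *.
assert (Hx : x ^ 2 = 1 - y ^ 2 - z ^ 2) by (simpl; lra).
ring [Hx].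
Qed.

End Zonal.

(** * Smoothness of zonal functions *)

Lemma continuous_coord i p : continuous (coord i) p.
Proof.
destruct p as [[x y] z]; destruct i; simpl.
- apply continuous_comp with (f := fst) (g := fst); apply continuous_fst.
- apply continuous_comp with (f := fst) (g := snd);
    [apply continuous_fst | apply continuous_snd].
- apply continuous_snd.
Qed.

Lemma is_derive_along_zonal phi i p :
  ex_derive phi (coord ax3 p) ->
  is_derive (along i (fun q => phi (coord ax3 q)) p) 0
    (coord i (basis ax3) * Derive phi (coord ax3 p)).
Proof.
intros Hphi; unfold along.
apply (is_derive_ext (fun h => phi (coord ax3 p + h * coord i (basis ax3)))).
  intros h; rewrite coord_plus, coord_scal; now destruct i.
auto_derive; rewrite Rmult_0_l, Rplus_0_r; [easy|].
rewrite (Derive_ext (fun x => phi x) phi) by easy.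
simpl; ring.
Qed.

(** A partial derivative of a zonal function is zonal, with profile a constant times [Derive phi];
    hence an induction over all profiles. *)
Lemma Ck_on_zonal k U phi :
  (forall n z, ex_derive_n phi n z) -> Ck_on k U (fun p => phi (coord ax3 p)).
Proof.
revert phi; induction k as [|k IH]; intros phi Hphi.
all: assert (Hd : forall z, ex_derive phi z) by exact (Hphi 1%nat).
all: split.
1, 3: intros p _; apply continuous_comp with (f := coord ax3);
  [apply continuous_coord | exact (ex_derive_continuous phi _ (Hd _))].
  easy.
intros i; split.
  intros p _; eexists; now apply is_derive_along_zonal.
replace (partial i _)
  with (fun p => coord i (basis ax3) * Derive phi (coord ax3 p)).
  apply (IH (fun z => coord i (basis ax3) * Derive phi z)); intros n z.
  apply ex_derive_n_scal_l.
  specialize (Hphi (S n) z).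
  destruct n as [|n]; [easy|]; simpl in *.
  apply ex_derive_ext with (2 := Hphi); intros u.
  change (Derive_n phi (S n) u = Derive_n (Derive_n phi 1) n u).
  now rewrite Derive_n_comp, Nat.add_1_r.
apply functional_extensionality; intros p; symmetry.
now apply is_derive_unique, is_derive_along_zonal.
Qed.

(** * Integration of zonal functions *)

Lemma sph_S2 theta phi : S2 (sph theta phi).
Proof.
unfold S2, dot, sum3, sph; simpl.
pose proof (sin2_cos2 theta) as Ht; pose proof (sin2_cos2 phi) as Hp.
unfold Rsqr in *; nra.
Qed.

(** Archimedes: z = cos theta carries the normalized surface measure to dz / 2 on [-1, 1]. The inner
    integral has primitive -A(cos theta). *)
Lemma S2_int_zonal (F : R3 -> R) (H A : R -> R) :
  (forall p, S2 p -> F p = H (coord ax3 p)) ->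
  (forall z, is_derive A z (H z)) -> (forall z, continuous H z) ->
  S2_int F = (A 1 - A (- 1)) / 2.
Proof.
intros HF HA HH; unfold S2_int.
rewrite (RInt_ext _ (fun _ => A 1 - A (- 1))).
  rewrite RInt_const; unfold scal; simpl; unfold mult; simpl.
  field; apply PI_neq0.
intros phi _.
rewrite (RInt_ext _ (fun theta => H (cos theta) * sin theta)).
  2: now intros theta _; rewrite HF by apply sph_S2.
apply is_RInt_unique.
replace (A 1 - A (- 1)) with (minus (- A (cos PI)) (- A (cos 0))).
  2: rewrite cos_PI, cos_0; unfold minus, plus, opp; simpl; ring.
apply (is_RInt_derive (fun theta => - A (cos theta))); intros theta _.
  assert (D := HA (cos theta)).
  auto_derive; [repeat split; eexists; eassumption|].
  rewrite (is_derive_unique (fun z : R => A z) _ _ D); ring.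
apply (continuous_mult (fun u => H (cos u)) sin).
  apply continuous_comp; [|apply HH].
all: apply continuity_pt_filterlim; [apply continuity_cos || apply continuity_sin].
Qed.

(** * The test functions and their two integrals *)

Definition bump (t : R) (p : R3) : R := (coord ax3 p ^ 2 + t) ^ 2.

Lemma smooth_bump t : smooth_on_S2 (bump t).
Proof.
exists (fun _ => True), (bump t); repeat split; [apply open_true|].
intros k; apply (Ck_on_zonal k _ (fun z => (z ^ 2 + t) ^ 2)); clear k.
intros n z.
apply ex_derive_n_ext with (fun z => z ^ 4 + (2 * t * z ^ 2 + t ^ 2));
  [intros; ring|].
assert (Hp : forall k m y, ex_derive_n (fun x => x ^ k) m y)
  by (intros; apply ex_derive_n_pow).
assert (Hs : forall m y, ex_derive_n (fun x => 2 * t * x ^ 2) m y)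
  by (intros; apply ex_derive_n_scal_l, Hp).
assert (Hc : forall m y, ex_derive_n (fun _ => t ^ 2) m y)
  by (intros; apply ex_derive_n_const).
assert (Hq : forall m y, ex_derive_n (fun x => 2 * t * x ^ 2 + t ^ 2) m y)
  by (intros; apply ex_derive_n_plus; apply filter_forall; auto).
apply ex_derive_n_plus; apply filter_forall; auto.
Qed.

Definition Phi (t : R) : R :=
  5 * (3 * t + 1) * (3 * t + 2)
  - 15 * (t + 1) * (3 * t + 1) * sqrt t * atan (1 / sqrt t).

Lemma is_derive_ln_bump t z :
  0 < t -> is_derive (fun z => ln ((z ^ 2 + t) ^ 2)) z (4 * z / (z ^ 2 + t)).
Proof.
intros Ht; auto_derive; [apply (pow_lt (z ^ 2 + t) 2); nra | field; nra].
Qed.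

Lemma is_derive_ln_bump' t z :
  0 < t ->
  is_derive (fun z => 4 * z / (z ^ 2 + t)) z
    (4 * (t - z ^ 2) / (z ^ 2 + t) ^ 2).
Proof. intros Ht; auto_derive; [nra | field; nra]. Qed.

(** The factor (z^2 + t)^2 cancels the denominator of |grad log f|^2, so the value does not depend
    on [t]. *)
Lemma bump_energy t :
  0 < t ->
  S2_int (fun p => bump t p * sgrad_norm2 (log_of (bump t)) p) = 32 / 15.
Proof.
intros Ht.
rewrite (S2_int_zonal _ (fun z => 16 * z ^ 2 * (1 - z ^ 2))
  (fun z => 16 * (z ^ 3 / 3 - z ^ 5 / 5))).
- field.
- intros p Hp.
  pose proof (sgrad_norm2_zonal _ _ (fun z => is_derive_ln_bump t z Ht) p Hp)
    as E.
  change (sgrad_norm2 _ p) with (sgrad_norm2 (log_of (bump t)) p) in E.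
  rewrite E; clear E.
  unfold bump; field; nra.
- intros z; auto_derive; [easy | field].
- intros z; apply (ex_derive_continuous (V := R_NormedModule)).
  auto_derive; easy.
Qed.

Lemma bump_Gamma2_energy t :
  0 < t ->
  S2_int (fun p => bump t p * Gamma2 (log_of (bump t)) p) = 32 / 15 * Phi t.
Proof.
intros Ht; pose proof (sqrt_lt_R0 _ Ht) as Hs.
assert (Hst : t = sqrt t ^ 2) by (symmetry; apply pow2_sqrt; lra).
(* The quotient equals -(1 + 2t) + 2t(1 + t) / (z^2 + t). Squaring it leaves 1 / (z^2 + t) and 1 /
   (z^2 + t)^2 to integrate; a primitive of the latter is (z / (z^2 + t) + atan(z / sqrt t) / sqrt
   t) / (2t). *)
rewrite (S2_int_zonal _
  (fun z => 16 * (((t - (1 + 2 * t) * z ^ 2) / (z ^ 2 + t)) ^ 2 + z ^ 2))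
  (fun z => 16 * ((1 + 2 * t) ^ 2 * z
     - 4 * t * (1 + t) * (1 + 2 * t) * (atan (z / sqrt t) / sqrt t)
     + 2 * t * (1 + t) ^ 2 * (z / (z ^ 2 + t) + atan (z / sqrt t) / sqrt t)
     + z ^ 3 / 3))).
- unfold Phi; replace (- 1 / sqrt t) with (- (1 / sqrt t)) by (field; lra).
  rewrite atan_opp.
  set (a := atan _); set (s := sqrt t) in *; rewrite Hst; field; nra.
- intros p Hp.
  pose proof (Gamma2_zonal _ _ _ (fun z => is_derive_ln_bump t z Ht)
    (fun z => is_derive_ln_bump' t z Ht) p Hp) as E.
  change (Gamma2 _ p) with (Gamma2 (log_of (bump t)) p) in E.
  rewrite E; clear E.
  unfold bump; field; nra.
- intros z; set (s := sqrt t) in *; rewrite Hst.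
  auto_derive; [repeat split; nra | field; repeat split; nra].
- intros z; apply (ex_derive_continuous (V := R_NormedModule)).
  auto_derive; nra.
Qed.

Lemma Gamma2_ineq_le_Phi Lambda t : Gamma2_ineq Lambda -> 0 < t -> Lambda <= Phi t.
Proof.
intros HL Ht.
assert (Hf := HL (bump t) (smooth_bump t)).
rewrite bump_energy, bump_Gamma2_energy in Hf by easy.
enough (32 / 15 * Phi t >= Lambda * (32 / 15)) by lra.
apply Hf.
  intros p _; unfold bump; apply pow_lt; nra.
intros p _; unfold bump; destruct p as [[x y] z]; simpl.
unfold opp; simpl; ring.
Qed.

(** * Minimization of the bound *)

Lemma nonneg_derive_le (f f' : R -> R) a b :
  a <= b ->
  (forall x, a <= x <= b -> is_derive f x (f' x)) ->
  (forall x, a <= x <= b -> 0 <= f' x) -> f a <= f b.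
Proof.
intros Hab Hd Hpos.
destruct (MVT_gen f a b f') as [c [Hc E]].
1, 2: rewrite Rmin_left, Rmax_right by easy; intros x Hx.
  apply Hd; lra.
  apply continuity_pt_filterlim, (ex_derive_continuous (V := R_NormedModule)).
  eexists; now apply Hd.
rewrite Rmin_left, Rmax_right in Hc by easy.
specialize (Hpos c Hc); nra.
Qed.

(** * Rational bounds for the arctangent *)

Definition atan_poly (n : nat) (x : R) : R :=
  sum_f_R0 (fun k => (- 1) ^ k * x ^ (2 * k + 1) / INR (2 * k + 1)) n.

Lemma is_derive_atan_poly n x :
  is_derive (atan_poly n) x ((1 - (- x ^ 2) ^ S n) / (1 + x ^ 2)).
Proof.
assert (Hmono : forall k, is_derive
  (fun y => (- 1) ^ k * y ^ (2 * k + 1) / INR (2 * k + 1)) x ((- x ^ 2) ^ k)).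
  intros k; assert (INR (2 * k + 1) <> 0) by (apply not_0_INR; lia).
  auto_derive; [easy|].
  replace (Init.Nat.pred _) with (2 * k)%nat by lia.
  rewrite pow_mult.
  replace (- x ^ 2) with ((- 1) * x ^ 2) by ring; rewrite Rpow_mult_distr.
  simpl Nat.add in *; field; easy.
induction n as [|n IH].
  replace ((1 - _) / _) with ((- x ^ 2) ^ 0) by (simpl; field; nra).
  apply (Hmono 0%nat).
replace ((1 - (- x ^ 2) ^ S (S n)) / (1 + x ^ 2))
  with (plus ((1 - (- x ^ 2) ^ S n) / (1 + x ^ 2)) ((- x ^ 2) ^ S n)).
  apply (is_derive_plus (V := R_NormedModule) (atan_poly n)); [apply IH | apply Hmono].
unfold plus; simpl; field; nra.
Qed.

Lemma atan_poly_0 n : atan_poly n 0 = 0.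
Proof.
apply sum_eq_R0; intros k _; rewrite (pow_i (2 * k + 1)) by lia.
unfold Rdiv; ring.
Qed.

Lemma is_derive_atan_sub_poly n x :
  is_derive (fun y => atan y - atan_poly n y) x
    ((- x ^ 2) ^ S n / (1 + x ^ 2)).
Proof.
replace ((- x ^ 2) ^ S n / (1 + x ^ 2))
  with (minus (/ (1 + Rsqr x)) ((1 - (- x ^ 2) ^ S n) / (1 + x ^ 2))).
  apply (is_derive_minus (V := R_NormedModule));
    [apply is_derive_atan | apply is_derive_atan_poly].
unfold minus, plus, opp, Rsqr; set (u := (- x ^ 2) ^ S n); simpl; field; nra.
Qed.

(** The remainder vanishes at 0 and its derivative (-x^2)^(m+1) / (1 + x^2) has a sign fixed by the
    parity of the order m, even for x > 1. *)
Lemma atan_bounds n x :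
  0 <= x -> atan_poly (2 * n + 1) x <= atan x <= atan_poly (2 * n) x.
Proof.
intros Hx; split.
- enough (atan 0 - atan_poly (2 * n + 1) 0 <= atan x - atan_poly (2 * n + 1) x)
    by (rewrite atan_0, atan_poly_0 in H; lra).
  apply nonneg_derive_le with (1 := Hx)
    (2 := fun y _ => is_derive_atan_sub_poly (2 * n + 1) y).
  intros y _; apply Rdiv_le_0_compat; [|nra].
  replace (S (2 * n + 1)) with (2 * (n + 1))%nat by lia.
  rewrite pow_mult; apply pow_le; nra.
- enough (- (atan 0 - atan_poly (2 * n) 0) <= - (atan x - atan_poly (2 * n) x))
    by (rewrite atan_0, atan_poly_0 in H; lra).
  apply nonneg_derive_le with (1 := Hx)
    (f := fun y => - (atan y - atan_poly (2 * n) y))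
    (2 := fun y _ => is_derive_opp (V := R_NormedModule) _ _ _
                       (is_derive_atan_sub_poly (2 * n) y)).
  intros y _; unfold opp; simpl opp.
  replace (- _) with ((y ^ 2) ^ (2 * n + 1) / (1 + y ^ 2)).
    apply Rdiv_le_0_compat; [apply pow_le|]; nra.
  replace (2 * n + 1)%nat with (S (2 * n)) by lia.
  rewrite <- (tech_pow_Rmult (- y ^ 2)), <- (tech_pow_Rmult (y ^ 2)), !pow_mult.
  replace ((- y ^ 2) ^ 2) with ((y ^ 2) ^ 2) by ring.
  field; nra.
Qed.

(** Taylor bounds are useless at an argument above 1, so PI / 4 is split off and expanded by
    Machin's formula; the remaining three arguments are small. *)
Lemma atan_482_401 :
  atan (482 / 401) = 4 * atan (/ 5) - atan (/ 239) + atan (81 / 883).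
Proof.
rewrite <- Machin_4_5_239, <- atan_1.
replace (81 / 883) with (atan_sub (482 / 401) 1) by (unfold atan_sub; field).
apply atan_sub_correct; [lra | | apply atan_bound].
assert (PI / 4 < atan (482 / 401)) by (rewrite <- atan_1; apply atan_increasing; lra).
pose proof (atan_bound (482 / 401)); rewrite atan_1; lra.
Qed.

Lemma atan_482_401_bounds :
  0.876874876 <= atan (482 / 401) <= 0.876874878.
Proof.
rewrite atan_482_401.
assert (H5 := atan_bounds 3 (/ 5)); assert (H239 := atan_bounds 1 (/ 239)).
assert (H883 := atan_bounds 2 (81 / 883)).
unfold atan_poly in *; simpl in *; lra.
Qed.

(** * A rational lower bound for the minimum *)

(* For [n = opt_const] the numerator of the derivative of [gap], a quadratic in
   [t = s ^ 2], vanishes at the rational point [t = (401 / 482) ^ 2], which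
   approximates the minimizer of [Phi]; its other root is [393125 / 250079].
   The resulting lower bound [10 - n] is about 3e-7 below the minimum. *)
Definition opt_const : R := 3792893587500 / 890124043279.

(** With t = s^2, the first numerator is 5(3t + 1)(3t + 2) - (10 - [opt_const]); dividing by the
    coefficient of the arctangent in [Phi] isolates it. *)
Definition gap (s : R) : R :=
  (45 * s ^ 4 + 45 * s ^ 2 + opt_const)
    / (15 * (s ^ 2 + 1) * (3 * s ^ 2 + 1) * s)
  - atan (1 / s).

Lemma Phi_gap s :
  0 < s ->
  Phi (s ^ 2) - (10 - opt_const) =
  15 * (s ^ 2 + 1) * (3 * s ^ 2 + 1) * s * gap s.
Proof.
intros Hs; unfold Phi, gap; rewrite sqrt_pow2 by lra.
field; nra.
Qed.

Definition gap' (s : R) : R :=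
  (opt_const - 4) * (s ^ 2 - (401 / 482) ^ 2) * (393125 / 250079 - s ^ 2)
    / ((s ^ 2 + 1) ^ 2 * (3 * s ^ 2 + 1) ^ 2 * s ^ 2).

Lemma is_derive_gap s : 0 < s -> is_derive gap s (gap' s).
Proof.
intros Hs; unfold gap, gap'.
auto_derive.
  repeat split; try lra; apply Rgt_not_eq;
  repeat apply Rmult_gt_0_compat; nra.
unfold opt_const; field; repeat split; nra.
Qed.

Lemma gap_opt_pos : 0 < gap (401 / 482).
Proof.
unfold gap, opt_const; replace (1 / (401 / 482)) with (482 / 401) by field.
pose proof atan_482_401_bounds; lra.
Qed.

(** The bound atan x <= x - x^3 / 3 + x^5 / 5 at x = 1 / sqrt t gives [Phi t] >= 6 - 7 / t - 3 /
    t^2. *)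
Lemma Phi_tail t : 36 <= t -> 5.8 <= Phi t.
Proof.
intros Ht; assert (Hs : 0 < sqrt t) by (apply sqrt_lt_R0; lra).
assert (Hst : t = sqrt t ^ 2) by (symmetry; apply pow2_sqrt; lra).
set (s := sqrt t) in *.
assert (Hi : 0 <= 1 / s) by (apply Rlt_le, Rdiv_lt_0_compat; lra).
destruct (atan_bounds 1 (1 / s) Hi) as [_ H].
assert (7 / t <= 7 / 36).
  apply Rmult_le_compat_l; [lra|]; apply Rinv_le_contravar; lra.
assert (3 / t ^ 2 <= 3 / 36 ^ 2).
  apply Rmult_le_compat_l; [lra|]; apply Rinv_le_contravar;
    [lra | apply pow_incr; lra].
apply Rle_trans with (6 - 7 / t - 3 / t ^ 2); [lra|].
unfold Phi; fold s; rewrite Hst; set (a := atan _) in *.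
unfold atan_poly in H; simpl in H.
replace (6 - 7 / s ^ 2 - 3 / (s ^ 2) ^ 2) with
  (5 * (3 * s ^ 2 + 1) * (3 * s ^ 2 + 2) - 15 * (s ^ 2 + 1) * (3 * s ^ 2 + 1) * s
   * (1 / s - (1 / s) ^ 3 / 3 + (1 / s) ^ 5 / 5)) by (field; lra).
apply Rplus_le_compat_l, Ropp_le_contravar, Rmult_le_compat_l.
  repeat apply Rmult_le_pos; nra.
lra.
Qed.

Lemma gap_nonneg s : 0 < s -> 0 <= gap s.
Proof.
intros Hs; pose proof gap_opt_pos as Hopt.
(* As [opt_const] > 4, [gap] decreases up to 401/482, increases until u^2 = 393125/250079, then
   decreases again. The turning point 401/482 settles the first two ranges. *)
assert (Hsign : forall u, 0 < u ->
    0 <= (u - 401 / 482) * (393125 / 250079 - u ^ 2) -> 0 <= gap' u).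
  intros u Hu H; unfold gap'.
  apply Rdiv_le_0_compat.
    replace (u ^ 2 - _) with ((u - 401 / 482) * (u + 401 / 482)) by ring.
    unfold opt_const; nra.
  repeat apply Rmult_lt_0_compat; nra.
assert (Hsign' : forall u, 0 < u ->
    (u - 401 / 482) * (393125 / 250079 - u ^ 2) <= 0 -> 0 <= - gap' u).
  intros u Hu H; unfold gap'; rewrite <- Rdiv_opp_l.
  apply Rdiv_le_0_compat.
    replace (u ^ 2 - _) with ((u - 401 / 482) * (u + 401 / 482)) by ring.
    unfold opt_const; nra.
  repeat apply Rmult_lt_0_compat; nra.
assert (Hdecr : forall a b, 0 < a -> a <= b ->
    (forall u, a <= u <= b -> (u - 401 / 482) * (393125 / 250079 - u ^ 2) <= 0) ->
    gap b <= gap a).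
  intros a b Ha Hab H; apply Ropp_le_cancel.
  apply nonneg_derive_le with (f := fun u => - gap u) (f' := fun u => - gap' u).
    easy.
    intros u Hu; apply (is_derive_opp (V := R_NormedModule)), is_derive_gap; lra.
  intros u Hu; apply Hsign'; [lra | auto].
destruct (Rle_lt_dec s (401 / 482)) as [H1|H1].
  enough (gap (401 / 482) <= gap s) by lra.
  apply Hdecr; [easy | easy |]; intros u Hu.
  assert (u ^ 2 <= (401 / 482) ^ 2) by (apply pow_incr; lra).
  nra.
destruct (Rle_lt_dec (s ^ 2) (393125 / 250079)) as [H2|H2].
  enough (gap (401 / 482) <= gap s) by lra.
  apply nonneg_derive_le with (f' := gap'); [lra | |]; intros u Hu.
    apply is_derive_gap; lra.
  apply Hsign; [lra |].
  assert (u ^ 2 <= s ^ 2) by (apply pow_incr; lra).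
  apply Rmult_le_pos; lra.
(* On the last decreasing range a lower bound must come from the right: for u >= 6, [Phi (u ^ 2)] >=
   5.8 exceeds 10 - [opt_const]. *)
assert (Htail : forall u, 6 <= u -> 0 <= gap u).
  intros u Hu; assert (Hw := Phi_tail (u ^ 2) ltac:(nra)).
  assert (Hg := Phi_gap u ltac:(lra)).
  assert (0 < 15 * (u ^ 2 + 1) * (3 * u ^ 2 + 1) * u)
    by (repeat apply Rmult_lt_0_compat; nra).
  apply Rmult_le_reg_l with (1 := H); rewrite Rmult_0_r, <- Hg.
  unfold opt_const; lra.
destruct (Rle_lt_dec 6 s) as [H3|H3]; [auto|].
apply Rle_trans with (gap 6); [apply Htail; lra|].
apply Hdecr; [easy | lra |]; intros u Hu.
assert (s ^ 2 <= u ^ 2) by (apply pow_incr; lra).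
nra.
Qed.

Lemma Phi_lower t : 0 < t -> 10 - opt_const <= Phi t.
Proof.
intros Ht; assert (Hs : 0 < sqrt t) by now apply sqrt_lt_R0.
pose proof (gap_nonneg _ Hs) as Hg; pose proof (Phi_gap _ Hs) as E.
rewrite pow2_sqrt in E by lra.
enough (0 <= 15 * (t + 1) * (3 * t + 1) * sqrt t * gap (sqrt t)) by lra.
repeat apply Rmult_le_pos; lra.
Qed.

(** * Existence and location of the minimum *)

Lemma Phi_opt_upper : Phi ((401 / 482) ^ 2) <= 5.738925.
Proof.
unfold Phi; rewrite sqrt_pow2 by lra.
replace (1 / (401 / 482)) with (482 / 401) by field.
pose proof atan_482_401_bounds; lra.
Qed.

(** The polynomial part is at least 10, while sqrt t <= 1/10 and atan < PI / 2 <= 2 keep the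
    subtracted term below 4. *)
Lemma Phi_small t : 0 < t <= 1 / 100 -> 5.738925 <= Phi t.
Proof.
intros Ht; unfold Phi.
assert (Hs : 0 < sqrt t <= 1 / 10).
  split; [apply sqrt_lt_R0; lra|].
  rewrite <- (sqrt_pow2 (1 / 10)) by lra; apply sqrt_le_1_alt; lra.
pose proof (atan_bound (1 / sqrt t)); pose proof PI_4.
set (a := atan _) in *; set (s := sqrt t) in *.
assert (s * a <= 1 / 10 * 2) by nra.
assert ((t + 1) * (3 * t + 1) <= 1.01 * 1.03) by nra.
assert ((t + 1) * (3 * t + 1) * (s * a) <= 1.01 * 1.03 * (1 / 10 * 2)) by nra.
nra.
Qed.

Lemma Phi_min : exists m, is_min_pos Phi m.
Proof.
(* Outside this interval [Phi] is at least 5.738925, hence at least its value at the interior point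
   (401/482)^2, so the minimum on the interval is global. *)
destruct (continuity_ab_min Phi (1 / 100) 36) as [t0 [Hmin Ht0]].
  lra.
  intros t Ht; apply continuity_pt_filterlim.
  apply (ex_derive_continuous (V := R_NormedModule)).
  unfold Phi; auto_derive; repeat split; try lra.
  apply Rgt_not_eq, sqrt_lt_R0; lra.
exists (Phi t0); split; [exists t0; split; [lra | easy]|].
assert (Hopt := Hmin ((401 / 482) ^ 2) ltac:(lra)).
pose proof Phi_opt_upper.
intros t Ht.
destruct (Rle_lt_dec t (1 / 100)) as [H1|H1].
  pose proof (Phi_small t); lra.
destruct (Rle_lt_dec t 36) as [H2|H2]; [apply Hmin; lra|].
pose proof (Phi_tail t); lra.
Qed.

Theorem theorem1p5 :
  exists m : R,
    is_min_pos
      (fun t => 5 * (3 * t + 1) * (3 * t + 2)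
                - 15 * (t + 1) * (3 * t + 1) * sqrt t * atan (1 / sqrt t)) m /\
    Rabs (m - 5.73892) <= 0.000005 /\
    (forall Lambda3 : R, is_largest Gamma2_ineq Lambda3 -> Lambda3 <= m).
Proof.
destruct Phi_min as [m Hm]; exists m; split; [exact Hm|].
destruct Hm as [[t [Ht <-]] Hmin]; split.
(* The lower end is the delicate one: 10 - [opt_const] is about 5.7389157, against the required
   5.738915. *)
- pose proof (Phi_lower t Ht) as Hlow; unfold opt_const in Hlow.
  pose proof (Hmin ((401 / 482) ^ 2) ltac:(lra)).
  pose proof Phi_opt_upper.
  apply Rabs_le; lra.
- intros L [HL _]; now apply Gamma2_ineq_le_Phi.
Qed.
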